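(* There exists a function $f:(0,1]\to\mathbb{N}$ such that the following holds. Let $R$ be a finite ring and let $\varepsilon=\mathrm{zp}(R)$. Then there exists a two-sided ideal $D$ of $R$ such that $[R:D]\le f(\varepsilon)$ and $\lvert D^2\rvert\le f(\varepsilon)$.
   Context: Rings are associative and not assumed to have an identity element. For a finite ring $R$, the zero-probability is $\mathrm{zp}(R)=\lvert\{(x,y)\in R\times R\mid xy=0\}\rvert/\lvert R\rvert^2$. The index $[R:D]$ is the index of $(D,+)$ in $(R,+)$ as additive groups. $D^2$ denotes the set of all products $d_1d_2$ with $d_1,d_2\in D$. The function $f$ depends only on $\varepsilon$ and not on $R$. *)

(* Defs.v *)
From mathcomp Require Import all_boot all_order all_algebra all_fingroup.
From mathcomp Require Import reals.

Set Implicit Arguments.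
Unset Strict Implicit.
Unset Printing Implicit Defensive.

Import Order.TTheory GRing.Theory Num.Theory.

Local Open Scope ring_scope.

(* MathComp's ring structures all contain a multiplicative identity, so finite
   associative rings without identity are bundled here on top of finZmodType.
   The carrier is not required to be nontrivial. *)
Record finRng := FinRng {
  rng_sort :> finZmodType;
  rng_mul : rng_sort -> rng_sort -> rng_sort;
  rng_mulA : associative rng_mul;
  rng_mulDl : left_distributive rng_mul +%R;
  rng_mulDr : right_distributive rng_mul +%R
}.

Arguments rng_mul {R} x y : rename.

Declare Scope rng_scope.
Delimit Scope rng_scope with rng.
Notation "x ** y" := (rng_mul x y)
  (at level 40, left associativity) : rng_scope.
Local Open Scope rng_scope.

Definition two_sided_ideal (R : finRng) (D : {set R}) : Prop :=
  [/\ zmod_closed D,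
      forall r d : R, d \in D -> r ** d \in D &
      forall r d : R, d \in D -> d ** r \in D].

(* Only the set of products, not the additive subgroup it generates. *)
Definition prod_set (R : finRng) (D : {set R}) : {set R} :=
  [set d1 ** d2 | d1 in D, d2 in D].

Definition zp (K : realType) (R : finRng) : K :=
  #|[set p : R * R | p.1 ** p.2 == 0]|%:R / #|R|%:R ^+ 2.

Lemma rng_mul0 (R : finRng) (x : R) : x ** 0 = 0.
Proof. by apply: (addrI (x ** 0)); rewrite -rng_mulDr !addr0. Qed.

Lemma zp_itv (K : realType) (R : finRng) : 0 < zp K R <= 1.
Proof.
have R0 : (0 < #|R|)%N by apply/card_gt0P; exists 0.
have R2 : 0 < #|R|%:R ^+ 2 :> K by rewrite exprn_gt0 ?ltr0n.
have Z0 : (0 < #|[set p : R * R | (p.1 ** p.2 == 0)%R]|)%N.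
  by apply/card_gt0P; exists (0, 0); rewrite inE /= rng_mul0.
apply/andP; split; first by rewrite divr_gt0 ?ltr0n.
by rewrite ler_pdivrMr // mul1r -natrX ler_nat -mulnn -card_prod max_card.
Qed.

(* Main.v *)
Require Import Defs.
From mathcomp Require Import all_boot all_order all_algebra all_fingroup.
From mathcomp Require Import reals.
From mathcomp Require Import zify.

(** For a single [x], multiplication by [x] is additive with image [xR], so [x]
    has [#|R| / #|xR|] right annihilators, and [zp R] is the average of
    [1 / #|xR|] over [x].  Hence if [zp R] is at least [2 / n], a proportion
    [1 / n] of the elements satisfy [#|xR| <= n].

    Let [X m] be the set of those [x] with [#|xR| <= m].  It is symmetric and
    stable under multiplication by [R] on both sides, and [X a + X b] lies in
    [X (a * b)].  So only closure under addition separates it from an ideal.  If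
    [X m + X m] is not closed under addition, some sum [s] of four elements of
    [X m] lies outside it, so the translate [s + X m] misses [X m]; both lie in
    [X (m ^ 5)], which therefore has at least twice as many elements
    ([sumset_or_double]).  Starting from [X n], which fills a proportion [1 / n]
    of [R], fewer than [n] doublings are possible, and some [X m + X m] with
    [m <= n ^ 5 ^ n] is an ideal of index at most [n]
    ([exists_small_mults_ideal]).  The opposite ring gives an ideal on which
    [#|Rx|] is bounded in the same way.  On the intersection [D] of the two
    ideals, both [#|dD|] and [#|Dd|] are at most some [N] that depends on [n].

    The argument used for groups with bounded conjugacy classes now
    bounds the set of all products ([card_prod_set_leq]).  Take [a] in [D] with
    [#|aD|] maximal, and [T] in [D] of at most [N] elements with [aT = aD].  If
    [c] in [D] annihilates [T], then [(a + c)D] contains [(a + c)T = aD], so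
    equality holds by maximality and [cD] lies in [aD - aD = aD].  There are at
    most [N ^ N] cosets of the annihilator of [T] in [D], and the products with
    left factor in the coset of [u] all lie in [uD + aD].  So there are at most
    [N ^ N * (N * N)] products. *)

Set Implicit Arguments.
Unset Strict Implicit.
Unset Printing Implicit Defensive.

Import Order.TTheory GRing.Theory Num.Theory.

Local Open Scope nat_scope.
Local Open Scope rng_scope.

(** * Rings without identity *)

Section FinRngBasics.
Variable R : finRng.
Implicit Types x y r : R.

Lemma rng_0mul x : 0%R ** x = 0%R.
Proof. by apply: (addrI (0%R ** x)); rewrite -rng_mulDl !addr0. Qed.

Lemma rng_mulNl x y : (- x)%R ** y = (- (x ** y))%R.
Proof. by apply/eqP; rewrite -addr_eq0 -rng_mulDl addNr rng_0mul. Qed.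

Lemma rng_mulBl x y r : (x - y)%R ** r = (x ** r - y ** r)%R.
Proof. by rewrite rng_mulDl rng_mulNl. Qed.

Lemma rng_mulNr x y : x ** (- y)%R = (- (x ** y))%R.
Proof. by apply/eqP; rewrite -addr_eq0 -rng_mulDr addNr rng_mul0. Qed.

Lemma rng_mulBr x y r : r ** (x - y)%R = (r ** x - r ** y)%R.
Proof. by rewrite rng_mulDr rng_mulNr. Qed.

Lemma card_rng_gt0 : 0 < #|R|.
Proof. by apply/card_gt0P; exists 0%R. Qed.

End FinRngBasics.

(** * Annihilators *)

Definition right_mults (R : finRng) (x : R) : {set R} := [set x ** y | y : R].

Lemma mem_right_mults (R : finRng) (x y : R) : x ** y \in right_mults x.
Proof. exact: imset_f. Qed.

(** A section of [f] over its image: a set of representatives of the fibres of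
    [f] on [D].  It serves to choose cosets of an annihilator as well as
    preimages of the values of a multiplication. *)
Lemma exists_section (aT rT : finType) (f : aT -> rT) (D : {set aT}) :
  exists U : {set aT},
    [/\ U \subset D, #|U| = #|f @: D|, {in U &, injective f} &
        forall d, d \in D -> exists2 u, u \in U & f u = f d].
Proof.
pose s z := [pick x in D | f x == z].
pose U := [set x in D | s (f x) == Some x].
have surjU d : d \in D -> exists2 u, u \in U & f u = f d.
  move=> dD; move: (erefl (s (f d))); rewrite {2}/s.
  case: pickP => [u /andP[uD /eqP fu] sd|/(_ d)]; last by rewrite dD eqxx.
  by exists u; rewrite // inE uD fu sd eqxx.
have injU : {in U &, injective f}.
  move=> x y; rewrite !inE => /andP[_ /eqP sx] /andP[_ /eqP sy] fxy.
  by apply: Some_inj; rewrite -sx -sy fxy.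
have sUD : U \subset D by apply/subsetP=> x; rewrite inE => /andP[].
exists U; split=> //; rewrite -(card_in_imset injU); apply/eqP.
rewrite eqn_leq subset_leq_card ?imsetS //; apply: subset_leq_card.
by apply/subsetP=> _ /imsetP[d /surjU[u uU <-] ->]; apply: imset_f.
Qed.

(** Translates of the annihilator by representatives of the fibres of
    multiplication by [x] are disjoint, and there are as many as multiples. *)
Lemma leq_card_annihilator (R : finRng) (x : R) :
  #|[set y | x ** y == 0%R]| * #|right_mults x| <= #|R|.
Proof.
have [U [_ cU injU _]] := exists_section (rng_mul x) [set: R].
have -> : right_mults x = rng_mul x @: [set: R].
  by apply/setP=> z; apply/imsetP/imsetP=> -[y _ ->]; exists y.
rewrite -cU -cardsX -(card_in_imset (f := fun p => (p.1 + p.2)%R)) ?max_card //.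
move=> [k u] [k' u']; rewrite !inE /= => /andP[/eqP kx uU] /andP[/eqP kx' uU'].
move=> eq_ku.
have eq_u : u = u'.
  apply: injU => //; rewrite -[LHS]add0r -kx -[RHS]add0r -kx' -!rng_mulDr.
  by rewrite eq_ku.
by congr (_, _) => //; move: eq_ku; rewrite eq_u => /addIr.
Qed.

(** * Elements with few multiples *)

Definition small_mults (R : finRng) m : {set R} :=
  [set x | #|right_mults x| <= m].

Definition sumset (R : finRng) (A : {set R}) : {set R} :=
  [set (x + y)%R | x in A, y in A].

Section SmallMults.
Variable R : finRng.
Implicit Types x y r : R.

Lemma small_mults0 m : 0 < m -> (0%R : R) \in small_mults R m.
Proof.
move=> m0; rewrite inE (leq_trans _ m0) // -(cards1 (0%R : R)).
by apply/subset_leq_card/subsetP=> _ /imsetP[y _ ->]; rewrite rng_0mul inE.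
Qed.

Lemma small_multsN m x : x \in small_mults R m -> (- x)%R \in small_mults R m.
Proof.
rewrite !inE; apply: leq_trans.
rewrite -(card_imset _ (@oppr_inj R)).
apply/subset_leq_card/subsetP=> _ /imsetP[_ /imsetP[y _ ->] ->].
by rewrite rng_mulNl opprK imset_f.
Qed.

Lemma small_multsD a b x y : x \in small_mults R a -> y \in small_mults R b ->
  (x + y)%R \in small_mults R (a * b).
Proof.
rewrite !inE => xa yb; apply: leq_trans (leq_mul xa yb).
rewrite -cardsX; apply: leq_trans (leq_imset_card (fun p : R * R => (p.1 + p.2)%R) _).
apply/subset_leq_card/subsetP=> _ /imsetP[z _ ->].
apply/imsetP; exists (x ** z, y ** z); rewrite ?rng_mulDl //.
by rewrite inE !mem_right_mults.
Qed.

Lemma small_multsMr m x r : x \in small_mults R m -> x ** r \in small_mults R m.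
Proof.
rewrite !inE; apply/leq_trans/subset_leq_card/subsetP=> _ /imsetP[z _ ->].
by rewrite -rng_mulA imset_f.
Qed.

Lemma small_multsMl m x r : x \in small_mults R m -> r ** x \in small_mults R m.
Proof.
rewrite !inE; apply: leq_trans.
apply: leq_trans (leq_imset_card (rng_mul r) _).
apply/subset_leq_card/subsetP=> _ /imsetP[z _ ->].
by rewrite -rng_mulA imset_f // imset_f.
Qed.

Lemma sub_small_mults m n : m <= n -> small_mults R m \subset small_mults R n.
Proof. by move=> mn; apply/subsetP=> x; rewrite !inE => /leq_trans->. Qed.

(** If the sum of [u] and [v] escapes the sumset, the translate of
    [small_mults R m] by [u + v] is disjoint from [small_mults R m], because a
    common element [w = u + v + x] would give [u + v = w + (- x)].  The exponent
    is [5] because [u] and [v] are sums of two elements each and the translate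
    adds a fifth. *)
Lemma sumset_or_double m : 0 < m ->
    {in sumset (small_mults R m) &, forall u v, (u + v)%R \in sumset (small_mults R m)}
  \/ 2 * #|small_mults R m| <= #|small_mults R (m ^ 5)|.
Proof.
move=> m0; set X := small_mults R m.
have [/forall_inP sD|] :=
  boolP [forall u in sumset X, forall v in sumset X, (u + v)%R \in sumset X].
  by left=> u v /sD/forall_inP; apply.
rewrite negb_forall_in => /exists_inP[u uX].
rewrite negb_forall_in => /exists_inP[v vX uvX]; right.
pose Y := [set (u + v + x)%R | x in X].
have cY : #|Y| = #|X| by apply/card_imset/addrI.
have dXY : [disjoint X & Y].
  apply/pred0P=> w /=; apply/negP=> /andP[wX /imsetP[x xX wE]].
  case/negP: uvX; apply/imset2P; exists w (- x)%R => //; first exact: small_multsN.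
  by rewrite wE addrK.
have sub2 w : w \in sumset X -> w \in small_mults R (m * m).
  by case/imset2P=> x y xX yX ->; apply: small_multsD.
have sX5 : X :|: Y \subset small_mults R (m ^ 5).
  apply/subsetP=> w /setUP[|/imsetP[x xX ->]].
    by apply/subsetP/sub_small_mults; rewrite -[leqLHS]expn1 leq_pexp2l.
  have -> : (m ^ 5 = m * m * (m * m) * m)%N by rewrite !expnS; lia.
  by apply: small_multsD xX; apply: small_multsD; apply: sub2.
apply: leq_trans (subset_leq_card sX5).
have [_] := leq_card_setU X Y; rewrite dXY => /eqP->.
by rewrite cY mul2n addnn.
Qed.

(** Each failure of closure doubles the set and raises [m] to its fifth power;
    [k] failures would overfill [R]. *)
Lemma sumset_closed_exponent k m : 0 < m -> #|R| < 2 ^ k * #|small_mults R m| ->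
  exists m', [/\ m <= m', m' <= m ^ (5 ^ k) &
    {in sumset (small_mults R m') &,
      forall u v, (u + v)%R \in sumset (small_mults R m')}].
Proof.
elim: k m => [|k IHk] m m0 ltRX.
  by move: ltRX; rewrite mul1n ltnNge max_card.
have [sD|dX] := sumset_or_double m0.
  by exists m; split=> //; rewrite -[leqLHS]expn1 leq_pexp2l ?expn_gt0.
have [||m' [m5 m'k sD]] := IHk (m ^ 5); first by rewrite expn_gt0 m0.
  apply: leq_trans ltRX _; rewrite expnS mulnAC (mulnC 2) -mulnA.
  rewrite [leqLHS](_ : _ = 2 ^ k * (2 * #|small_mults R m|)); last by lia.
  by rewrite leq_mul2l dX orbT.
exists m'; split=> //; last by rewrite expnS expnM.
by apply: leq_trans m5; rewrite -[leqLHS]expn1 leq_pexp2l.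
Qed.

(** Markov's inequality for the sizes of annihilators.  An element outside
    [small_mults R n] annihilates at most [#|R| / n] elements, so all of these
    together account for at most half of the zero products; the factor [2]
    leaves the other half to [small_mults R n]. *)
Lemma card_small_mults n :
  2 * #|R| ^ 2 <= n * #|[set p : R * R | p.1 ** p.2 == 0%R]| ->
  #|R| <= n * #|small_mults R n|.
Proof.
set Z := [set p | _] => hZ.
have cZ : #|Z| = \sum_(x : R) #|[set y | x ** y == 0%R]|.
  rewrite -sum1_card (eq_bigl (fun p : R * R => p.1 ** p.2 == 0%R)); last first.
    by move=> p; rewrite inE.
  rewrite -(pair_big_dep predT (fun x y => x ** y == 0%R) (fun _ _ => 1)) /=.
  by apply: eq_bigr => x _; rewrite -sum1_card; apply: eq_bigl => y; rewrite inE.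
have bound x : n * #|[set y | x ** y == 0%R]| <=
    #|R| + (if x \in small_mults R n then n * #|R| else 0).
  case: ifPn => [_|].
    by rewrite (leq_trans _ (leq_addl _ _)) // leq_mul2l max_card orbT.
  rewrite inE -ltnNge addn0 => /ltnW ltn; apply: leq_trans (leq_card_annihilator x).
  by rewrite mulnC leq_mul2l ltn orbT.
have : n * #|Z| <= #|R| * #|R| + #|small_mults R n| * (n * #|R|).
  rewrite cZ big_distrr /=; apply: leq_trans (leq_sum _ (fun x _ => bound x)) _.
  rewrite big_split /= sum_nat_const -big_mkcond /= sum_nat_const //.
move/(leq_trans hZ); rewrite -mulnn mul2n -addnn leq_add2l mulnA.
by rewrite leq_pmul2r ?card_rng_gt0 // mulnC.
Qed.

Lemma sumset_small_mults_ideal m : 0 < m ->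
  {in sumset (small_mults R m) &, forall u v, (u + v)%R \in sumset (small_mults R m)} ->
  two_sided_ideal (sumset (small_mults R m)).
Proof.
move=> m0 sD; split.
- split=> [|u v uS /imset2P[x y xX yX ->]].
    by apply/imset2P; exists 0%R 0%R; rewrite ?small_mults0 ?addr0.
  by apply: sD => //; rewrite opprD imset2_f ?small_multsN.
- move=> r _ /imset2P[x y xX yX ->]; rewrite rng_mulDr.
  by rewrite imset2_f ?small_multsMl.
- move=> r _ /imset2P[x y xX yX ->]; rewrite rng_mulDl.
  by rewrite imset2_f ?small_multsMr.
Qed.

End SmallMults.

(** The inner power bounds the threshold reached by repeated doubling; it is
    squared because the ideal is a sum of two copies of [small_mults]. *)
Definition mults_bound n := (n ^ (5 ^ n)) ^ 2.

Lemma exists_small_mults_ideal (R : finRng) n : 0 < n ->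
  2 * #|R| ^ 2 <= n * #|[set p : R * R | p.1 ** p.2 == 0%R]| ->
  exists D : {set R},
    [/\ two_sided_ideal D, #|R| <= n * #|D| &
        D \subset small_mults R (mults_bound n)].
Proof.
move=> n0 /card_small_mults cX.
have X0 : 0 < #|small_mults R n|.
  by apply/card_gt0P; exists 0%R; apply: small_mults0.
have [||m [nm mN sD]] := @sumset_closed_exponent R n n; first by [].
  (* [2 ^ n] exceeds the inverse density [n] of [small_mults R n] *)
  by apply: leq_ltn_trans cX _; rewrite ltn_pmul2r // ltn_expl.
have m0 := leq_trans n0 nm.
exists (sumset (small_mults R m)); split.
- exact: sumset_small_mults_ideal.
- apply: leq_trans cX _; rewrite leq_mul2l; apply/orP; right.
  apply: subset_leq_card; apply: subset_trans (sub_small_mults R nm) _.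
  apply/subsetP=> x xX; apply/imset2P; exists x 0%R; rewrite ?small_mults0 ?addr0 //.
- apply/subsetP=> _ /imset2P[x y xX yX ->].
  apply: (subsetP (sub_small_mults R _)) (small_multsD xX yX).
  by rewrite mulnn leq_sqr.
Qed.

(** * The opposite ring and intersections of ideals *)

(** The opposite ring exchanges right and left multiples, and thus halves the
    work above. *)
Definition opp_finRng (R : finRng) : finRng :=
  @FinRng R (fun x y => y ** x) (fun x y z => esym (rng_mulA z y x))
    (fun x y z => rng_mulDr z x y) (fun x y z => rng_mulDl y z x).

Lemma card_zero_pairs_opp (R : finRng) :
  #|[set p : opp_finRng R * opp_finRng R | p.1 ** p.2 == 0%R]| =
  #|[set p : R * R | p.1 ** p.2 == 0%R]|.
Proof.
pose swap (p : R * R) := (p.2, p.1).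
have swapK : involutive swap by case.
rewrite -[RHS](card_imset _ (inv_inj swapK)); apply: eq_card => p.
apply/idP/imsetP => [|[q]]; rewrite inE => pq.
  by exists (swap p); rewrite ?swapK // inE.
by move=> ->; rewrite inE.
Qed.

Lemma two_sided_ideal_opp (R : finRng) (D : {set R}) :
  two_sided_ideal (R := opp_finRng R) D -> two_sided_ideal D.
Proof. by case=> ? dl dr; split. Qed.

Lemma two_sided_idealI (R : finRng) (D E : {set R}) :
  two_sided_ideal D -> two_sided_ideal E -> two_sided_ideal (D :&: E).
Proof.
move=> [[D0 DB] Dl Dr] [[E0 EB] El Er]; split.
- split=> [|x y]; rewrite !inE; first exact/andP.
  by move=> /andP[? ?] /andP[? ?]; apply/andP; split; [apply: DB | apply: EB].
- by move=> r d; rewrite !inE => /andP[/Dl-> /El->].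
- by move=> r d; rewrite !inE => /andP[/Dr-> /Er->].
Qed.

Lemma zmod_closed_group_set (V : finZmodType) (D : {set V}) :
  zmod_closed D -> group_set D.
Proof.
move=> [D0 DB]; apply/group_setP; split=> // x y xD yD.
by rewrite FinRing.zmodMgE -[y]opprK DB // -[X in X \in D]add0r DB.
Qed.

Lemma index_setI_zmod (V : finZmodType) (D E : {set V}) n :
  zmod_closed D -> zmod_closed E ->
  #|V| <= n * #|D| -> #|V| <= n * #|E| -> #|[set: V] : D :&: E|%g <= n ^ 2.
Proof.
move=> /zmod_closed_group_set gD /zmod_closed_group_set gE cD cE.
pose DG := Group gD; pose EG := Group gE.
have V0 : 0 < #|V| by apply/card_gt0P; exists 0%R.
have := Lagrange (subsetT (DG :&: EG)); rewrite cardsT /= => LG.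
have := mul_cardG DG EG; rewrite /= => mulDE.
have DE0 : 0 < #|D :&: E| by rewrite (cardG_gt0 (DG :&: EG)).
have := leq_mul cD cE; rewrite mulnACA mulDE.
have : #|(D * E)%g| <= #|V| by rewrite max_card.
set i := #|_ : _|%g in LG *; move=> cDE cVV.
rewrite -(leq_pmul2l DE0) LG -(leq_pmul2l V0); apply: leq_trans cVV _.
by rewrite [leqRHS]mulnA [leqRHS]mulnC mulnn leq_mul2l leq_mul2r cDE !orbT.
Qed.

(** * Counting products *)

Lemma foldr_muln_leq (T : eqType) (F : T -> nat) N (s : seq T) :
  (forall x, x \in s -> F x <= N) -> foldr muln 1 (map F s) <= N ^ size s.
Proof.
elim: s => //= x s IHs leF; rewrite expnS leq_mul ?leF ?mem_head //.
by apply: IHs => y ys; rewrite leF // inE ys orbT.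
Qed.

(** The bounded conjugacy class argument for the biadditive map [**]: the
    maximality of [#|aD|] forces every [d] that annihilates [T] to have all its
    multiples in [aD].  The map [phi] records the action on [T], so that equal
    values of [phi] mean a difference that annihilates [T]. *)
Lemma card_prod_set_leq (R : finRng) (D : {set R}) N :
  zmod_closed D ->
  (forall d, d \in D -> #|[set d ** b | b in D]| <= N) ->
  (forall d, d \in D -> #|[set b ** d | b in D]| <= N) ->
  #|prod_set D| <= N ^ N * (N * N).
Proof.
move=> [D0 DB] leL leR.
have DD x y : x \in D -> y \in D -> (x + y)%R \in D.
  by move=> xD yD; rewrite -[y]opprK DB // -[X in X \in D]add0r DB.
pose img d := [set d ** b | b in D].
have [a aD amax] : exists2 a, a \in D & forall d, d \in D -> #|img d| <= #|img a|.
  by have [a aD amax] := arg_maxnP (fun d => #|img d|) D0; exists a.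
have [T [sTD cT injT surjT]] := exists_section (rng_mul a) D.
pose phi d : {ffun R -> R} := [ffun b => if b \in T then d ** b else 0%R].
have [U [sUD cU _ surjU]] := exists_section phi D.
have N0 : 0 < N.
  apply: leq_trans (leL _ D0).
  by apply/card_gt0P; exists (0%R ** 0%R); apply: imset_f.
have leU : #|U| <= N ^ N.
  have leT : #|T| <= N by rewrite cT leL.
  apply: leq_trans (leq_pexp2l N0 leT); rewrite cU.
  apply: (@leq_trans #|pfamily 0%R T (fun b => mem [set d ** b | d in D])|).
    apply/subset_leq_card/subsetP=> _ /imsetP[d dD ->].
    apply/pfamilyP; split=> [|b bT]; last by rewrite ffunE bT; apply: imset_f.
    by apply/subsetP=> b; rewrite inE ffunE; case: ifP => //; rewrite eqxx.
  rewrite card_pfamily [#|T| in leqRHS]cardE; apply: foldr_muln_leq => b.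
  by rewrite mem_enum => bT; rewrite leR // (subsetP sTD).
(* [d = u + (d - u)] where [d - u] annihilates [T]. *)
have sub : prod_set D \subset \bigcup_(u in U) [set (x + y)%R | x in img u, y in img a].
  apply/subsetP=> _ /imset2P[d b dD bD ->].
  have [u uU phiu] := surjU d dD; have uD := subsetP sUD u uU.
  apply/bigcupP; exists u => //.
  have annT t : t \in T -> (d - u)%R ** t = 0%R.
    move=> tT; have /ffunP/(_ t) := phiu.
    by rewrite !ffunE tT rng_mulBl => ->; rewrite subrr.
  have duD : (a + (d - u))%R \in D by rewrite DD // DB.
  have eq_img : img a = img (a + (d - u))%R.
    apply/eqP; rewrite eqEcard amax // andbT; apply/subsetP=> _ /imsetP[b' b'D ->].
    have [t tT <-] := surjT b' b'D.
    by apply/imsetP; exists t; rewrite ?(subsetP sTD) // rng_mulDl annT ?addr0.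
  have : (a + (d - u))%R ** b \in img a by rewrite eq_img imset_f.
  case/imsetP=> b' b'D; rewrite rng_mulDl => eqb.
  apply/imset2P; exists (u ** b) (a ** (b' - b)%R); rewrite ?imset_f ?DB //.
  by rewrite rng_mulBr -eqb addrAC subrr add0r rng_mulBl addrC subrK.
apply: leq_trans (subset_leq_card sub) _.
have card_bigcup (F : R -> {set R}) : #|\bigcup_(u in U) F u| <= \sum_(u in U) #|F u|.
  apply: (big_ind2 (fun (A : {set R}) k => #|A| <= k)) => [|A k B l Ak Bl|//].
    by rewrite cards0.
  exact: leq_trans (leq_card_setU A B) (leq_add Ak Bl).
apply: leq_trans (card_bigcup _) _.
apply: leq_trans (leq_mul leU (leqnn _)); rewrite -sum_nat_const.
apply: leq_sum => u uU; have uD := subsetP sUD u uU.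
rewrite (leq_trans _ (leq_mul (leL u uD) (leL a aD))) // -cardsX.
apply: leq_trans (leq_imset_card (fun p : R * R => (p.1 + p.2)%R) _).
apply/subset_leq_card/subsetP=> _ /imset2P[x y xu ya ->].
by apply/imsetP; exists (x, y); rewrite ?inE ?xu.
Qed.

(** * The structure theorem *)

Definition ideal_bound n :=
  let N := mults_bound n in maxn (n ^ 2) (N ^ N * (N * N)).

Lemma exists_ideal (R : finRng) n : 0 < n ->
  2 * #|R| ^ 2 <= n * #|[set p : R * R | p.1 ** p.2 == 0%R]| ->
  exists D : {set R},
    [/\ two_sided_ideal D, #|[set: R] : D|%g <= ideal_bound n &
        #|prod_set D| <= ideal_bound n].
Proof.
move=> n0 hZ.
have [D [iD cD sD]] := exists_small_mults_ideal n0 hZ.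
have := @exists_small_mults_ideal (opp_finRng R) n n0.
rewrite card_zero_pairs_opp => /(_ hZ)[E [/two_sided_ideal_opp iE cE sE]].
have iDE := two_sided_idealI iD iE; exists (D :&: E); split=> //.
  by rewrite leq_max index_setI_zmod //; [case: iD | case: iE].
rewrite leq_max; apply/orP; right; apply: card_prod_set_leq; first by case: iDE.
  move=> d /setIP[/(subsetP sD)+ _]; rewrite inE; apply: leq_trans.
  by apply/subset_leq_card/subsetP=> _ /imsetP[b _ ->]; apply: imset_f.
move=> d /setIP[_ /(subsetP sE)]; rewrite inE; apply: leq_trans.
apply/subset_leq_card/subsetP=> _ /imsetP[b _ ->].
by apply/imsetP; exists b.
Qed.

Theorem theorem1p3 (K : realType) :
  exists f : {e : K | (0 < e <= 1)%R} -> nat,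
  forall R : finRng,
    let eps : {e : K | (0 < e <= 1)%R} := exist _ (zp K R) (zp_itv K R) in
    exists D : {set R},
      [/\ two_sided_ideal D,
          #|[set: R] : D|%g <= f eps &
          #|prod_set D| <= f eps].
Proof.
(* [2 / e <= n] makes the hypothesis of [exists_ideal] hold when [zp] is [e]. *)
exists (fun e => ideal_bound (Num.bound (2 / sval e)%R)) => R /=.
have /andP[zp0 _] := zp_itv K R.
have := archi_boundP (ltW (divr_gt0 (ltr0Sn K 1) zp0)).
move: (Num.bound _) => n ltn.
have n0 : 0 < n.
  by rewrite -(ltr0n K); apply: lt_trans ltn; rewrite divr_gt0.
apply: exists_ideal => //; rewrite -(ler_nat K) !natrM -expr2.
rewrite -ler_pdivlMr ?exprn_gt0 ?ltr0n ?card_rng_gt0 // -mulrA.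
by move: ltn; rewrite ltr_pdivrMr // => /ltW.
Qed.
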